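(* Assume (A1)–(A6) and that the numerical integrator $\Psi$ has order $p\ge1$ in $X$ for the problems $w'(s)=f(t_n+s,w(s))$. Let $\overline{v}_n$ be the generalized solution of $\overline{v}_n'=A\overline{v}_n$, $\overline{v}_n(0)=u(t_n)$, $\partial\overline{v}_n(s)=\partial(u(t_n)+sAu(t_n))$, and let $\overline{u}_{n+1}=\Psi_k^{f,t_n}(\overline{v}_n(k))$ (one step of the modified exponential Lie–Trotter method started from the exact value). Then the local error satisfies $$\rho_{n+1}:=\overline{u}_{n+1}-u(t_{n+1})=O(k^2).$$
   Context: Let $X,Y$ be Banach spaces, $T>0$, $A:D(A)\subset X\to X$ and $\partial:D(A)\to Y$ linear operators, $f:[0,T]\times X\to X$, $g:[0,T]\to Y$, and let $u$ be the solution of $u'(t)=Au(t)+f(t,u(t))$, $u(0)=u_0$, $\partial u(t)=g(t)$, $0\le t\le T$. Standing hypotheses: (A1) $\partial$ is onto. (A2) $\ker\partial$ is dense in $X$ and the restriction $A_0$ of $A$ to $D(A_0)=\ker\partial$ generates a $C_0$-semigroup $(e^{tA_0})_{t\ge0}$ on $X$ of negative type $\omega$. (A3) For every $z\in\mathbb C$ with $\Re z>\omega$ and $v\in Y$, the problem $Ax=zx$, $\partial x=v$ has a unique solution $x=:K(z)v\in D(A)$, and $\|K(z)v\|\le C\|v\|$ with $C$ uniform for $\Re z\ge\omega_0>\omega$. (A4) $f\in C^1([0,T]\times X,X)$. (A5) $u\in C^2([0,T],X)$, $u(t)\in D(A^2)$ for all $t$, and $Au,A^2u\in C^1([0,T],X)$.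 (A6) $f(t,u(t))\in D(A)$ for all $t$ and $Af(\cdot,u(\cdot))\in C([0,T],X)$. Generalized solution: for $u_0\in X$, $v_0,v_1\in Y$, the generalized solution of $w'(s)=Aw(s)$, $w(0)=u_0$, $\partial w(s)=v_0+v_1s$ is $w(s)=e^{sA_0}(u_0-K(0)v_0)+K(0)(v_0+v_1s)-\int_0^s e^{\sigma A_0}K(0)v_1\,d\sigma$. Time step $k>0$, $t_n=nk$. For $\tau\in[0,T]$, $\Psi_k^{f,\tau}(v_0)$ denotes one step of size $k$ of a numerical integrator applied to $v'(s)=f(\tau+s,v(s))$, $v(0)=v_0$; order $p$ means $\Psi_k^{f,\tau}(v_0)-v(k)=O(k^{p+1})$ uniformly for the arguments considered. Notation $a=O(b)$ means $\|a\|\le Cb$ with $C$ independent of $k$ (small enough) and of $n$ with $0\le nk\le T$. *)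

(* Defs.v *)
From HB Require Import structures.
From mathcomp Require Import all_boot all_order all_algebra.
From mathcomp Require Import all_classical all_reals all_analysis.
From mathcomp Require Import complex.
Set Implicit Arguments. Unset Strict Implicit. Unset Printing Implicit Defensive.
Import Order.TTheory GRing.Theory Num.Theory.
Import numFieldNormedType.Exports.
Local Open Scope ring_scope.
Local Open Scope classical_set_scope.
Local Open Scope complex_scope.

Section Defs.
Variable R : realType.

Definition cI (a b : R) : set R := [set t | a <= t <= b].

Definition lin_subspace (V : lmodType R[i]) (D : set V) :=
  D 0 /\ forall (a : R[i]) x y, D x -> D y -> D (a *: x + y).

Definition linear_on (V W : lmodType R[i]) (D : set V) (L : V -> W) :=
  forall (a : R[i]) x y, D x -> D y -> L (a *: x + y) = a *: L x + L y.

Definition bounded_linear (V W : normedModType R[i]) (L : V -> W) :=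
  (forall (a : R[i]) x y, L (a *: x + y) = a *: L x + L y) /\
  exists M : R, forall x, `|L x| <= M%:C * `|x|.

Definition bounded_Rlinear (V W : normedModType R[i]) (L : V -> W) :=
  (forall (a : R) x y, L (a%:C *: x + y) = a%:C *: L x + L y) /\
  exists M : R, forall x, `|L x| <= M%:C * `|x|.

Definition has_deriv_on (V : normedModType R[i]) (a b : R) (F F' : R -> V) :=
  forall t, a <= t <= b ->
    (fun h : R => (h^-1)%:C *: (F (t + h) - F t))
      @ within [set h : R | h != 0 /\ a <= t + h <= b] (nbhs (0 : R))
      --> F' t.

Definition C1_on (V : normedModType R[i]) (a b : R) (F : R -> V) :=
  exists F' : R -> V, has_deriv_on a b F F' /\ {within cI a b, continuous F'}.

Definition C2_on (V : normedModType R[i]) (a b : R) (F : R -> V) :=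
  exists F' F'' : R -> V, [/\ has_deriv_on a b F F', has_deriv_on a b F' F''
                            & {within cI a b, continuous F''}].

(* f in C^1([0,T] x V, V): f is (real) Frechet differentiable on [0,T] x V,
   with derivative (h,y) |-> h ft(t,x) + fx(t,x) y, and the derivative is
   continuous (fx in operator norm). *)
Definition C1_TX (V : normedModType R[i]) (T : R) (f : R -> V -> V) :=
  exists (ft : R -> V -> V) (fx : R -> V -> V -> V),
  [/\ forall t x, 0 <= t <= T -> bounded_Rlinear (fx t x),
      forall t x, 0 <= t <= T -> forall e : R, 0 < e -> exists2 d : R, 0 < d &
        forall (h : R) (y : V), 0 <= t + h <= T -> `|h| < d -> `|y| < d%:C ->
          `|f (t + h) (x + y) - f t x - h%:C *: ft t x - fx t x y|
            <= (e * `|h|)%:C + e%:C * `|y| &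
      forall t x, 0 <= t <= T -> forall e : R, 0 < e -> exists2 d : R, 0 < d &
        forall (t' : R) (x' : V), 0 <= t' <= T -> `|t' - t| < d -> `|x' - x| < d%:C ->
          `|ft t' x' - ft t x| <= e%:C /\
          forall y, `|fx t' x' y - fx t x y| <= e%:C * `|y| ].

Definition C0_semigroup (V : normedModType R[i]) (S : R -> V -> V) :=
  [/\ forall t, 0 <= t -> bounded_linear (S t),
      forall x, S 0 x = x,
      forall t s x, 0 <= t -> 0 <= s -> S (t + s) x = S t (S s x) &
      forall x, S t x @[t --> 0^'+] --> x ].

Definition generator (V : normedModType R[i]) (S : R -> V -> V)
    (D : set V) (G : V -> V) :=
  forall x,
    (D x <-> exists y : V, (h^-1)%:C *: (S h x - x) @[h --> 0^'+] --> y) /\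
    (D x -> (h^-1)%:C *: (S h x - x) @[h --> 0^'+] --> G x).

Definition negative_type (V : normedModType R[i]) (S : R -> V -> V) (w : R) :=
  w < 0 /\ exists M : R, forall t x, 0 <= t -> `|S t x| <= (M * expR (w * t))%:C * `|x|.

Definition rint (V : normedModType R[i]) (F : R -> V) (a b : R) : V :=
  limn (fun n : nat =>
    \sum_(i < n) ((b - a) / n%:R)%:C *: F (a + (i%:R * (b - a)) / n%:R)).

(* generalized solution of w' = A w, w(0) = u0, bd w(s) = v0 + v1 s:
   w(s) = S s (u0 - K0 v0) + K0 (v0 + v1 s) - int_0^s S sigma (K0 v1) dsigma *)
Definition gen_sol (V W : normedModType R[i]) (S : R -> V -> V) (K0 : W -> V)
    (u0 : V) (v0 v1 : W) (s : R) : V :=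
  S s (u0 - K0 v0) + K0 (v0 + s%:C *: v1) - rint (fun sigma => S sigma (K0 v1)) 0 s.

End Defs.

(* Main.v *)
(** The generalized solution started at [u t] satisfies
    [vbar k = u t + k A (u t) + O(k^2)]: with [b = A (u t) - K(0) bd (A (u t))],
    which lies in the domain of the generator, the boundary corrections cancel
    and leave [u t + k A (u t)] plus the integral over [0, k] of [S s b - b],
    where [S s b - b = O(s)] because [b] is in that domain.  Since [f] is
    Lipschitz in a tube around the compact trajectory, the nonlinear flow started
    at [vbar k] stays in the tube and adds [k f(t, u t) + O(k^2)].  The sum is the
    first-order Taylor polynomial of [u] at [t], so it differs from [u (t + k)]
    by [O(k^2)].  Uniformity in [t] comes from compactness of [0, T], always used
    in the form of Cousin's lemma. *)
Require Import Defs.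
From HB Require Import structures.
From mathcomp Require Import all_boot all_order all_algebra.
From mathcomp Require Import all_classical all_reals all_analysis.
From mathcomp Require Import complex.
Import Order.TTheory GRing.Theory Num.Theory.
Import numFieldNormedType.Exports.
Local Open Scope ring_scope.
Local Open Scope classical_set_scope.
Local Open Scope complex_scope.
From mathcomp Require Import ring lra.

Set Implicit Arguments. Unset Strict Implicit. Unset Printing Implicit Defensive.

(** * Real-valued norms over the complex scalars *)

Definition rnorm (R : realType) (V : normedModType R[i]) (x : V) : R :=
  complex.Re `|x|.

(** Norms take values in [R[i]] but are real elements, so the real part loses nothing and estimates
    can be carried out in the ordered field [R]. *)
Lemma normE (R : realType) (V : normedModType R[i]) (x : V) :
  `|x| = (rnorm x)%:C.
Proof.
rewrite /rnorm; by have /complex_realP [k ->] : `|x| \is Num.real by exact: normr_real.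
Qed.

Lemma rnorm_ge0 (R : realType) (V : normedModType R[i]) (x : V) :
  0 <= rnorm x.
Proof. by rewrite -lecR -normE rmorph0 normr_ge0. Qed.

Lemma rnormD (R : realType) (V : normedModType R[i]) (x y : V) :
  rnorm (x + y) <= rnorm x + rnorm y.
Proof. by rewrite -lecR rmorphD /= -!normE ler_normD. Qed.

Lemma rnorm_distD (R : realType) (V : normedModType R[i]) (z x y : V) :
  rnorm (x - y) <= rnorm (x - z) + rnorm (z - y).
Proof. by rewrite -lecR rmorphD /= -!normE ler_distD. Qed.

Lemma rnormN (R : realType) (V : normedModType R[i]) (x : V) :
  rnorm (- x) = rnorm x.
Proof. by rewrite /rnorm normrN. Qed.

Lemma rnorm_distC (R : realType) (V : normedModType R[i]) (x y : V) :
  rnorm (x - y) = rnorm (y - x).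
Proof. by rewrite /rnorm distrC. Qed.

Lemma rnormB (R : realType) (V : normedModType R[i]) (x y : V) :
  rnorm (x - y) <= rnorm x + rnorm y.
Proof. by rewrite -(rnormN y) rnormD. Qed.

Lemma rnorm0 (R : realType) (V : normedModType R[i]) : rnorm (0 : V) = 0.
Proof. by rewrite /rnorm normr0. Qed.

Lemma rnorm0_eq0 (R : realType) (V : normedModType R[i]) (x : V) :
  rnorm x = 0 -> x = 0.
Proof. by move=> x0; apply/eqP; rewrite -normr_eq0 normE x0. Qed.

Lemma norm_realC (R : realType) (a : R) : `|a%:C| = `|a|%:C.
Proof. by rewrite normc_def /= expr0n /= addr0 sqrtr_sqr. Qed.

Lemma rnormZ (R : realType) (V : normedModType R[i]) (a : R) (x : V) :
  rnorm (a%:C *: x) = `|a| * rnorm x.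
Proof.
apply: (@complexI R).
by rewrite -normE normrZ norm_realC rmorphM /= -normE.
Qed.

Lemma rnorm_sum_nat (R : realType) (V : normedModType R[i]) (m n : nat)
    (F : nat -> V) (e : R) :
  (forall i, (m <= i < n)%N -> rnorm (F i) <= e) ->
  rnorm (\sum_(m <= i < n) F i) <= (n - m)%:R * e.
Proof.
move=> Fe; rewrite mulr_natl -sumr_const_nat big_nat [leRHS]big_nat.
elim/big_rec2: _ => [|i y x mn xy]; first by rewrite rnorm0.
by apply: le_trans (rnormD _ _) _; rewrite lerD // Fe.
Qed.

(** A positive element of [R[i]] is real, so real tolerances [e] suffice. *)
Lemma cvg_rnormP (R : realType) (V : normedModType R[i]) (I : Type)
    (F : set_system I) (FF : Filter F) (f : I -> V) (l : V) :
  f x @[x --> F] --> l <->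
  forall e : R, 0 < e -> \forall x \near F, rnorm (f x - l) <= e.
Proof.
rewrite cvgrPdist_le; split => fl e e0.
  near=> x; rewrite rnorm_distC -lecR -normE.
  by near: x; apply: fl; rewrite ltcR.
have eE : e = (complex.Re e)%:C.
  by have /complex_realP[k ->] : e \is Num.real by exact: gtr0_real.
have := fl (complex.Re e); rewrite -ltcR -eE => /(_ e0); apply: filterS => x.
by rewrite -lecR -normE -eE distrC.
Unshelve. all: by end_near. Qed.

(** Compactness in the form used throughout: a property of intervals that is additive, and true of
    all short intervals around each point, holds globally. The supremum of the [x] with [P a x] can
    be passed unless it equals [b]. *)
Lemma cousin (R : realType) (P : R -> R -> Prop) (a b : R) :
  (forall x y z, a <= x -> x <= y -> y <= z -> z <= b ->
     P x y -> P y z -> P x z) ->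
  (forall c, a <= c <= b -> exists2 d : R, 0 < d &
     forall x y, a <= x -> x <= c -> c <= y -> y <= b -> y - x < d -> P x y) ->
  a <= b -> P a b.
Proof.
move=> Padd Ploc ab.
pose E : set R := [set x | a <= x <= b /\ P a x].
have Ea : E a.
  split; first by rewrite lexx.
  have [|d d0] := Ploc a; first by rewrite lexx.
  by apply; rewrite ?lexx // subrr.
have ubE : ubound E b by move=> x [/andP[]].
have supE : has_sup E by split; [exists a | exists b].
have as_ : a <= sup E by apply: sup_upper_bound.
have sb : sup E <= b by apply: ge_sup => //; exists a.
have [|d d0 Pd] := Ploc (sup E); first by rewrite as_.
have d20 : 0 < d / 2 by lra.
have [x [/andP[ax xb] Pax] sx] := sup_adherent d20 supE.
have xs : x <= sup E by apply: sup_upper_bound => //; split=> //; rewrite ax.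
(* Since [x] is within [d / 2] below the supremum and [y] within [d / 3] above it, [y - x < d]. *)
pose y := Num.min b (sup E + d / 3).
have sy : sup E <= y by rewrite /y le_min sb /=; lra.
have yb : y <= b by rewrite /y ge_min lexx.
have yd : y <= sup E + d / 3 by rewrite /y ge_min lexx orbT.
have Pay : P a y.
  apply: (Padd a x y) => //; first lra.
  by apply: Pd => //; lra.
have ys : y <= sup E.
  by apply: sup_upper_bound => //; split=> //; apply/andP; split=> //; lra.
by move: ys Pay; rewrite /y; case: (leP b (sup E + d / 3)) => // ?; lra.
Qed.

(** * Calculus on a compact interval *)

Lemma has_deriv_onP (R : realType) (V : normedModType R[i]) (a b : R)
    (F F' : R -> V) :
  has_deriv_on a b F F' <->
  forall t, a <= t <= b -> forall e : R, 0 < e -> exists2 d : R, 0 < d &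
    forall h, a <= t + h <= b -> `|h| < d ->
      rnorm (F (t + h) - F t - h%:C *: F' t) <= e * `|h|.
Proof.
have scale (t h e : R) : h != 0 ->
    (rnorm ((h^-1)%:C *: (F (t + h) - F t) - F' t) <= e) =
    (rnorm (F (t + h) - F t - h%:C *: F' t) <= e * `|h|).
  move=> h0; rewrite -ler_pdivrMr ?normr_gt0 // mulrC -normfV -rnormZ.
  by rewrite [in RHS]scalerBr scalerA -rmorphM /= mulVf // scale1r.
split=> H t abt.
  move=> e e0; have /cvg_rnormP/(_ e e0) := H t abt.
  rewrite near_withinE => /nbhs_ballP[d /= d0 Hd]; exists d => // h abh hd.
  have [->|h0] := eqVneq h 0.
    by rewrite addr0 subrr scale0r subr0 rnorm0 normr0 mulr0.
  rewrite -scale //; apply: Hd => //=.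
  by rewrite /ball /= sub0r normrN.
apply/cvg_rnormP => e e0; have [d d0 Hd] := H t abt e e0.
rewrite near_withinE; apply/nbhs_ballP; exists d => //= h.
by rewrite /ball /= sub0r normrN => hd [h0 abh]; rewrite scale // Hd.
Qed.

Lemma continuous_withinP (R : realType) (V : normedModType R[i]) (a b : R)
    (F : R -> V) :
  {within cI a b, continuous F} <->
  forall t, a <= t <= b -> forall e : R, 0 < e -> exists2 d : R, 0 < d &
    forall s, a <= s <= b -> `|s - t| < d -> rnorm (F s - F t) <= e.
Proof.
rewrite subspace_continuousP; split=> H t abt.
  move=> e e0; have /cvg_rnormP/(_ e e0) := H t abt.
  rewrite near_withinE => /nbhs_ballP[d /= d0 Hd]; exists d => // s abs sd.
  by apply: Hd => //; rewrite /ball /= distrC.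
apply/cvg_rnormP => e e0; have [d d0 Hd] := H t abt e e0.
rewrite near_withinE; apply/nbhs_ballP; exists d => //= s.
by rewrite /ball /= distrC => sd abs; apply: Hd.
Qed.
Lemma has_deriv_on_sub (R : realType) (V : normedModType R[i])
    (a b c d : R) (F F' : R -> V) :
  a <= c -> d <= b -> has_deriv_on a b F F' -> has_deriv_on c d F F'.
Proof.
move=> ac db /has_deriv_onP HF; apply/has_deriv_onP => t ctd e e0.
have abt : a <= t <= b by lra.
have [r r0 Hr] := HF t abt e e0; exists r => // h cth.
by apply: Hr; lra.
Qed.

Lemma has_deriv_on_affine (R : realType) (V : normedModType R[i])
    (a b : R) (F F' : R -> V) (v : V) :
  has_deriv_on a b F F' ->
  has_deriv_on a b (fun s => F s - s%:C *: v) (fun s => F' s - v).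
Proof.
move=> /has_deriv_onP HF; apply/has_deriv_onP => t abt e e0.
have [r r0 Hr] := HF t abt e e0; exists r => // h abh hr.
rewrite [X in rnorm X](_ : _ = F (t + h) - F t - h%:C *: F' t); first exact: Hr.
rewrite rmorphD /= scalerDl scalerBr !opprD !opprK.
set p := F (t + h); set q := _ *: v; set r1 := _ *: v.
rewrite [LHS](AC ((1*2)*2*2) (1*4*6*(5*2)*(7*3))) /=.
by rewrite !subrr !addr0.
Qed.

Lemma has_deriv_on_continuous (R : realType) (V : normedModType R[i])
    (a b : R) (F F' : R -> V) :
  has_deriv_on a b F F' -> {within cI a b, continuous F}.
Proof.
move=> /has_deriv_onP HF; apply/continuous_withinP => t abt e e0.
have [r r0 Hr] := HF t abt 1 ltr01.
pose m := 1 + rnorm (F' t); have m0 : 0 < m.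
  by rewrite /m; have := rnorm_ge0 (F' t); lra.
exists (Num.min r (e / m)); first by rewrite lt_min r0 divr_gt0.
move=> s abs; rewrite lt_min => /andP[sr]; rewrite ltr_pdivlMr // => sm.
have := Hr (s - t); rewrite subrKC => /(_ abs sr) h1.
have := rnorm_distD ((s - t)%:C *: F' t) (F s - F t) 0.
rewrite !subr0 rnormZ => h2.
by apply: le_trans h2 _; move: sm; rewrite /m mulrDr; lra.
Qed.

(** With slope [M + e'] the bound is additive by the triangle inequality, and near each [c] it
    follows from differentiability at [c]; Cousin's lemma makes it global. *)
Lemma mean_value (R : realType) (V : normedModType R[i])
    (a b M : R) (F F' : R -> V) :
  a <= b -> has_deriv_on a b F F' ->
  (forall t, a <= t <= b -> rnorm (F' t) <= M) ->
  rnorm (F b - F a) <= M * (b - a).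
Proof.
move=> ab /has_deriv_onP HF FM; apply/ler_addgt0Pr => e e0.
(* The added 1 keeps the quotient defined when [a = b] and gives [e' (b - a) <= e]. *)
pose e' := e / (b - a + 1).
have e'0 : 0 < e' by rewrite divr_gt0 //; lra.
suff H : rnorm (F b - F a) <= (M + e') * (b - a).
  apply: le_trans H _; rewrite mulrDl lerD2l /e' mulrAC ler_pdivrMr ?ler_pM2l //; lra.
apply: (@cousin R (fun x y => rnorm (F y - F x) <= (M + e') * (y - x))) => //.
  move=> x y z _ _ _ _ xy yz; have := rnorm_distD (F y) (F z) (F x); lra.
move=> c abc; have [d d0 Hd] := HF c abc e' e'0; exists d => // x y ax xc cy yb xyd.
have step s : a <= s <= b -> `|s - c| < d -> rnorm (F s - F c) <= (M + e') * `|s - c|.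
  move=> abs sd; have := Hd (s - c); rewrite subrKC => /(_ abs sd) h1.
  have := rnorm_distD ((s - c)%:C *: F' c) (F s - F c) 0.
  rewrite !subr0 rnormZ => h2.
  have := ler_wpM2l (normr_ge0 (s - c)) (FM c abc); lra.
have hy : rnorm (F y - F c) <= (M + e') * (y - c).
  by have := step y; rewrite ger0_norm ?subr_ge0 //; apply; lra.
have hx : rnorm (F c - F x) <= (M + e') * (c - x).
  by have := step x; rewrite distrC ger0_norm ?subr_ge0 // rnorm_distC; apply; lra.
have := rnorm_distD (F c) (F y) (F x); lra.
Qed.

(** This later identifies the derivative supplied by the [C^2] hypothesis on [u] with the right-hand
    side of the evolution equation. *)
Lemma has_deriv_on_uniq (R : realType) (V : normedModType R[i])
    (a b : R) (F F1 F2 : R -> V) :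
  a < b -> has_deriv_on a b F F1 -> has_deriv_on a b F F2 ->
  forall t, a <= t <= b -> F1 t = F2 t.
Proof.
move=> ab /has_deriv_onP H1 /has_deriv_onP H2 t abt.
apply/eqP; rewrite -subr_eq0; apply/eqP/rnorm0_eq0/le_anti.
rewrite rnorm_ge0 andbT; apply/ler_addgt0Pr => e e0; rewrite add0r.
have e20 : 0 < e / 2 by lra.
have [d1 d10 Hd1] := H1 t abt _ e20; have [d2 d20 Hd2] := H2 t abt _ e20.
(* A third of the length leaves room for [t + r] or [t - r] in the interval, even when [t] is an
   endpoint. *)
pose r := Num.min (Num.min d1 d2) (b - a) / 3.
have [r0 rd1 rd2 rab] : [/\ 0 < r, r < d1, r < d2 & 3 * r <= b - a].
  have : 0 < Num.min (Num.min d1 d2) (b - a).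
    by rewrite !lt_min d10 d20 subr_gt0.
  have : Num.min (Num.min d1 d2) (b - a) <= d1 by rewrite !ge_min lexx.
  have : Num.min (Num.min d1 d2) (b - a) <= d2 by rewrite !ge_min lexx orbT.
  have : Num.min (Num.min d1 d2) (b - a) <= b - a by rewrite ge_min lexx orbT.
  by rewrite /r => *; split; lra.
have [h [hr abh]] : exists h, `|h| = r /\ a <= t + h <= b.
  have [tb|tb] := leP (t + r) b; first by exists r; rewrite gtr0_norm //; split=> //; lra.
  by exists (- r); rewrite normrN gtr0_norm //; split=> //; lra.
have := Hd1 h abh; have := Hd2 h abh; rewrite hr => /(_ rd2) h2 /(_ rd1) h1.
have h3 : r * rnorm (F1 t - F2 t) <= r * e.
  rewrite -hr -rnormZ hr scalerBr.
  rewrite [X in rnorm X](_ : _ = (F (t + h) - F t - h%:C *: F2 t)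
     - (F (t + h) - F t - h%:C *: F1 t)).
    by apply: le_trans (rnormB _ _) _; lra.
  by rewrite opprB [RHS]addrC subrKA.
by rewrite ler_pM2l in h3.
Qed.

Lemma continuous_bounded (R : realType) (V : normedModType R[i])
    (a b : R) (F : R -> V) :
  a <= b -> {within cI a b, continuous F} ->
  exists2 B, 0 <= B & forall t, a <= t <= b -> rnorm (F t) <= B.
Proof.
move=> ab /continuous_withinP HF.
apply: (@cousin R (fun x y => exists2 B, 0 <= B &
  forall t, x <= t <= y -> rnorm (F t) <= B)) => //.
  move=> x y z _ _ _ _ [B B0 HB] [C C0 HC]; exists (B + C); first lra.
  move=> t xtz; have [ty|ty] := leP t y.
    by have := HB t; rewrite ty; lra.
  by have := HC t; rewrite (ltW ty); lra.
move=> c abc; have [d d0 Hd] := HF c abc 1 ltr01; exists d => // x y ax xc cy yb xyd.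
exists (1 + rnorm (F c)); first by have := rnorm_ge0 (F c); lra.
move=> t xty; have h1 : rnorm (F t - F c) <= 1.
  by apply: Hd; [lra | rewrite ltr_norml; lra].
by have := rnormD (F t - F c) (F c); rewrite subrK; lra.
Qed.

(** * Riemann sums of semigroup orbits *)

Definition riemann_sum (R : realType) (V : normedModType R[i])
    (F : R -> V) (k : R) (n : nat) : V :=
  \sum_(0 <= i < n) (k / n%:R)%:C *: F (i%:R * k / n%:R).

(** The sum over a [nat] range is the form in which blocks can be split and differences
    telescoped. *)
Lemma rint0E (R : realType) (V : normedModType R[i]) (F : R -> V) (k : R) :
  rint F 0 k = limn (riemann_sum F k).
Proof.
rewrite /rint; congr (limn _); apply/funext => n.
rewrite /riemann_sum big_mkord; apply: eq_bigr => i _.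
by rewrite subr0 add0r.
Qed.

Lemma riemann_sumB (R : realType) (V : normedModType R[i])
    (F G : R -> V) (k : R) (n : nat) :
  riemann_sum (fun s => F s - G s) k n = riemann_sum F k n - riemann_sum G k n.
Proof.
rewrite /riemann_sum -sumrB; apply: eq_bigr => i _; exact: scalerBr.
Qed.

Section Lipschitz.
Context (R : realType) (V : completeNormedModType R[i]).
Context (F : R -> V) (k L : R).
Context (k0 : 0 < k) (L0 : 0 <= L).
Context (Flip : forall s t, 0 <= s -> s <= t -> t <= k ->
  rnorm (F t - F s) <= L * (t - s)).

(** Each coarse term is cut into [m] equal copies. Every fine node lies within [k / n] of its coarse
    node, so [n m] terms of weight [k / (n m)] each err by at most [L k / n]. *)
Lemma riemann_sum_refine (n m : nat) : (0 < n)%N -> (0 < m)%N ->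
  rnorm (riemann_sum F k (n * m) - riemann_sum F k n) <= L * k ^+ 2 / n%:R.
Proof.
move=> n0 m0.
have n0R : 0 < n%:R :> R by rewrite ltr0n.
have m0R : 0 < m%:R :> R by rewrite ltr0n.
have -> : riemann_sum F k n = \sum_(0 <= i < n) \sum_(i * m <= j < i.+1 * m)
    (k / (n * m)%:R)%:C *: F (i%:R * k / n%:R).
  apply: eq_bigr => i _; rewrite sumr_const_nat -mulnBl subSnn mul1n.
  rewrite -[RHS]scaler_nat scalerA -(rmorph_nat (real_complex R)) -rmorphM /=.
  congr (_%:C *: _); rewrite natrM; field.
  by rewrite !pnatr_eq0 -!lt0n n0 m0.
rewrite /riemann_sum big_nat_mul -sumrB.
rewrite (_ : L * k ^+ 2 / n%:R = (n - 0)%:R * (L * k ^+ 2 / n%:R ^+ 2)); last first.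
  by rewrite subn0; field; rewrite pnatr_eq0 -lt0n.
apply: rnorm_sum_nat => i /andP[_ ilt]; rewrite -sumrB.
rewrite (_ : L * k ^+ 2 / n%:R ^+ 2 =
   (i.+1 * m - i * m)%:R * (k / (n * m)%:R * (L * (k / n%:R)))); last first.
  rewrite -mulnBl subSnn mul1n natrM; field.
  by rewrite !pnatr_eq0 -!lt0n n0 m0.
apply: rnorm_sum_nat => j /andP[jge jlt].
have nm0 : 0 < (n * m)%:R :> R by rewrite ltr0n muln_gt0 n0.
rewrite -scalerBr rnormZ ger0_norm; last by rewrite divr_ge0 // ltW.
apply: ler_wpM2l; first by rewrite divr_ge0 // ltW.
have jR : (i * m)%:R <= j%:R :> R by rewrite ler_nat.
have jR1 : j%:R <= (i.+1 * m)%:R :> R by rewrite ler_nat ltnW.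
have jnm : j%:R <= (n * m)%:R :> R.
  by rewrite ler_nat (leq_trans (ltnW jlt)) // leq_mul2r ilt orbT.
have e1 : i%:R * k / n%:R = (i * m)%:R * (k / (n * m)%:R).
  rewrite !natrM; field; by rewrite !pnatr_eq0 -!lt0n n0 m0.
have e2 : (i.+1 * m)%:R * (k / (n * m)%:R) = i%:R * k / n%:R + k / n%:R.
  rewrite !natrM -natr1; field; by rewrite !pnatr_eq0 -!lt0n n0 m0.
have e3 : (n * m)%:R * (k / (n * m)%:R) = k.
  by rewrite mulrC divfK // gt_eqF.
have h0 : 0 <= k / (n * m)%:R by rewrite divr_ge0 // ltW.
have h1 := ler_wpM2r h0 jR; have h2 := ler_wpM2r h0 jR1.
have h3 := ler_wpM2r h0 jnm.
have e4 : j%:R * k / (n * m)%:R = j%:R * (k / (n * m)%:R) by rewrite mulrA.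
rewrite e4; apply: le_trans (Flip _ _ _) _.
- by rewrite !mulr_ge0 ?ler0n ?invr_ge0 ?ler0n // ltW.
- by rewrite e1 h1.
- by rewrite -[leRHS]e3.
- by apply: ler_wpM2l => //; rewrite lerBlDl -e2.
Qed.

(** The sums with [N] and [n] nodes are both compared with their common refinement [N * n], which
    makes the sequence Cauchy. *)
Lemma riemann_sum_lipschitz_cvg : cvgn (riemann_sum F k).
Proof.
apply/cauchy_cvgP/cauchy_exP => e e0.
have eE : e = (complex.Re e)%:C.
  by have /complex_realP[r ->] : e \is Num.real by exact: gtr0_real.
set r := complex.Re e in eE; have r0 : 0 < r by rewrite -ltcR -eE.
pose q := 2 * (L * k ^+ 2 / r) + 1.
have q0 : 0 <= q by rewrite addr_ge0 // mulr_ge0 // divr_ge0 ?mulr_ge0 ?sqr_ge0 // ltW.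
have small n : (Num.Def.truncn q < n)%N -> L * k ^+ 2 / n%:R < r / 2.
  move=> qn; have qn' : q < n%:R.
    by apply: lt_le_trans (truncnS_gt q) _; rewrite ler_nat.
  rewrite ltr_pdivrMr; last by apply: le_lt_trans q0 _.
  have : r * (q / 2) < r * (n%:R / 2) by rewrite ltr_pM2l //; lra.
  have -> : r * (q / 2) = L * k ^+ 2 + r / 2 by rewrite /q; field; rewrite gt_eqF.
  lra.
exists (riemann_sum F k (Num.Def.truncn q).+1).
exists (Num.Def.truncn q).+1 => //= n /= qn.
rewrite -ball_normE /= normE eE ltcR.
set N := (Num.Def.truncn q).+1 in qn *.
have n0 : (0 < n)%N by apply: leq_trans qn.
have h1 := @riemann_sum_refine N n isT n0.
have h2 := @riemann_sum_refine n N n0 isT.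
have h3 := small N (leqnn _); have h4 := small n qn.
rewrite mulnC in h2; rewrite rnorm_distC in h1.
have := rnorm_distD (riemann_sum F k (N * n)) (riemann_sum F k N) (riemann_sum F k n).
lra.
Qed.

Lemma rnorm_riemann_sum_le (n : nat) (B : R) : (0 < n)%N ->
  (forall s, 0 <= s <= k -> rnorm (F s) <= B) ->
  rnorm (riemann_sum F k n) <= k * B.
Proof.
move=> n0 FB.
have n0R : 0 < n%:R :> R by rewrite ltr0n.
rewrite (_ : k * B = (n - 0)%:R * (k / n%:R * B)); last first.
  by rewrite subn0; field; rewrite pnatr_eq0 -lt0n.
apply: rnorm_sum_nat => i /andP[_ ilt].
have h0 : 0 <= k / n%:R by rewrite divr_ge0 // ltW.
rewrite rnormZ ger0_norm //; apply: ler_wpM2l => //; apply: FB.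
rewrite -mulrA mulr_ge0 ?ler0n //=.
have : i%:R * (k / n%:R) <= n%:R * (k / n%:R) by rewrite ler_wpM2r // ler_nat ltnW.
by rewrite [leRHS]mulrC divfK // gt_eqF.
Qed.
End Lipschitz.

(** * Semigroup orbits and the generalized solution *)

Section Semigroup.
Context (R : realType) (V : completeNormedModType R[i]).
Context (S : R -> V -> V) (D : set V) (G : V -> V) (M : R).
Context (HS : C0_semigroup S) (HG : generator S D G) (M0 : 0 <= M).
Context (SM : forall t x, 0 <= t -> rnorm (S t x) <= M * rnorm x).

Lemma semigroupL (t a : R) (x y : V) : 0 <= t ->
  S t (a%:C *: x + y) = a%:C *: S t x + S t y.
Proof. by case: HS => Sl _ _ _ t0; case: (Sl t t0) => ->. Qed.

Lemma semigroupB (t : R) (x y : V) : 0 <= t -> S t (x - y) = S t x - S t y.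
Proof.
move=> t0; have := semigroupL (-1) y x t0.
by rewrite rmorphN rmorph1 !scaleN1r addrC => ->; rewrite addrC.
Qed.

Lemma semigroupZ (t a : R) (x : V) : 0 <= t -> S t (a%:C *: x) = a%:C *: S t x.
Proof.
move=> t0; have := semigroupL a x 0 t0; rewrite addr0 => ->.
by have := semigroupB 0 0 t0; rewrite !subrr => ->; rewrite addr0.
Qed.

(* Telescope [S k x - x] over the grid; each increment is
   [S (i h) (S h x - x)], and [S h x - x = h (G x + o(1))]. *)
Lemma riemann_sum_generator (k : R) (x : V) : 0 < k -> D x ->
  riemann_sum (fun s => S s (G x)) k n @[n --> \oo] --> S k x - x.
Proof.
move=> k0 Dx; case: HS => _ S0 SD _.
(* The [n] increments contribute [n h M e' = k M e'] in total, and [k M e' + e' = e]. *)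
apply/cvg_rnormP => e e0; pose e' := e / (k * M + 1).
have kM0 : 0 <= k * M by rewrite mulr_ge0 // ltW.
have e'0 : 0 < e' by rewrite divr_gt0 //; lra.
have := (HG x).2 Dx => /cvg_rnormP/(_ e' e'0).
rewrite near_withinE => /nbhs_ballP[d /= d0 Hd].
(* From this index on, the mesh [k / n] is smaller than [d]. *)
exists (Num.Def.truncn (k / d)).+1 => //= n /= qn.
have n0 : (0 < n)%N by apply: leq_trans qn.
have n0R : 0 < n%:R :> R by rewrite ltr0n.
set h := k / n%:R; have h0 : 0 < h by rewrite divr_gt0.
have hd : h < d.
  rewrite /h ltr_pdivrMr // mulrC -ltr_pdivrMr //.
  by apply: lt_le_trans (truncnS_gt _) _; rewrite ler_nat.
have gridE (i : nat) : i%:R * k / n%:R = i%:R * h by rewrite /h mulrA.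
have -> : S k x - x = \sum_(0 <= i < n) h%:C *: S (i%:R * h) (h^-1%:C *: (S h x - x)).
  have -> : S k x - x = S (n%:R * h) x - S (0%:R * h) x.
    by rewrite mul0r S0 /h mulrC divfK ?gt_eqF.
  rewrite -(telescope_sumr (fun i : nat => S (i%:R * h) x)) //; apply: eq_bigr => i _ /=.
  have ih0 : 0 <= i%:R * h by rewrite mulr_ge0 ?ler0n // ltW.
  rewrite semigroupZ // scalerA -rmorphM /= mulfV ?gt_eqF // scale1r.
  by rewrite semigroupB // -(SD _ _ _ ih0 (ltW h0)) -natr1 mulrDl mul1r.
rewrite /riemann_sum -sumrB.
have -> : e = (n - 0)%:R * (h * (M * e')) + e'.
  rewrite subn0 /h /e'; field.
  by rewrite pnatr_eq0 -lt0n n0 andbT gt_eqF //; lra.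
rewrite -[leLHS]addr0; apply: lerD; last exact: ltW.
apply: rnorm_sum_nat => i _.
have ih0 : 0 <= i%:R * h by rewrite mulr_ge0 ?ler0n // ltW.
rewrite gridE -scalerBr rnormZ gtr0_norm // ler_pM2l // -semigroupB //.
apply: le_trans (SM _ ih0) _; apply: ler_wpM2l => //.
rewrite rnorm_distC; apply: Hd => //=.
by rewrite /ball /= sub0r normrN gtr0_norm.
Qed.

(** The increment is [S s] applied to [S (t - s) x - x], which is a limit of Riemann sums of the
    orbit of [G x]. One factor [M] bounds [S s], the other that orbit. *)
Lemma semigroup_lipschitz (x : V) (s t : R) : D x -> 0 <= s -> s <= t ->
  rnorm (S t x - S s x) <= M ^+ 2 * rnorm (G x) * (t - s).
Proof.
move=> Dx s0; rewrite le_eqVlt => /predU1P[->|st].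
  by rewrite !subrr rnorm0 mulr0.
have ts0 : 0 < t - s by rewrite subr_gt0.
have -> : S t x - S s x = S s (S (t - s) x - x).
  case: HS => _ _ SD _.
  by rewrite semigroupB // -SD ?subr_ge0 ?(ltW st) // subrKC.
apply: le_trans (SM _ s0) _; rewrite expr2 -!mulrA; apply: ler_wpM2l => //.
apply/ler_addgt0Pr => e e0.
have /cvg_rnormP/(_ e e0)[N _ HN] := riemann_sum_generator ts0 Dx.
have := HN N.+1 (leqnSn N); set r := riemann_sum _ _ _ => h1.
have h2 : rnorm r <= (t - s) * (M * rnorm (G x)).
  apply: rnorm_riemann_sum_le => // q /andP[q0 _]; exact: SM.
have := rnorm_distD r (S (t - s) x - x) 0; rewrite !subr0 rnorm_distC.
by rewrite [M * (_ * _)]mulrA [_ * (t - s)]mulrC; lra.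
Qed.

(** The orbit is Lipschitz, so its sums converge; on [[0, k]] it stays within [L k] of [x], whose
    constant sums equal [k x]. *)
Lemma riemann_sum_orbit_cvg (k : R) (x : V) : 0 < k -> D x ->
  exists2 I : V, riemann_sum (fun s => S s x) k n @[n --> \oo] --> I &
    rnorm (I - k%:C *: x) <= M ^+ 2 * rnorm (G x) * k ^+ 2.
Proof.
move=> k0 Dx; pose L := M ^+ 2 * rnorm (G x).
have L0 : 0 <= L by rewrite mulr_ge0 ?sqr_ge0 ?rnorm_ge0.
have lip s t : 0 <= s -> s <= t -> t <= k ->
    rnorm (S t x - S s x) <= L * (t - s).
  by move=> s0 st _; exact: semigroup_lipschitz.
exists (limn (riemann_sum (fun s => S s x) k)).
  exact: riemann_sum_lipschitz_cvg lip.
set I := limn _.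
apply/ler_addgt0Pr => e e0.
have /cvg_rnormP/(_ e e0)[N _ HN] := riemann_sum_lipschitz_cvg k0 L0 lip.
have := HN N.+1 (leqnSn N); rewrite -/I => h1.
have h2 : rnorm (riemann_sum (fun s => S s x) k N.+1 - k%:C *: x) <= L * k ^+ 2.
  have <- : riemann_sum (fun=> x) k N.+1 = k%:C *: x.
    rewrite /riemann_sum sumr_const_nat subn0 -[LHS]scaler_nat scalerA.
    by rewrite -(rmorph_nat (real_complex R)) -rmorphM /= mulrC divfK.
  rewrite -riemann_sumB (_ : L * k ^+ 2 = k * (L * k)); last by ring.
  apply: rnorm_riemann_sum_le => // s /andP[s0 sk].
  case: HS => _ S0 _ _; have := lip 0 s (lexx _) s0 sk.
  rewrite S0 subr0 => /le_trans; apply; exact: ler_wpM2l.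
have := rnorm_distD (riemann_sum (fun s => S s x) k N.+1) I (k%:C *: x).
by rewrite -/L [rnorm (I - riemann_sum _ _ _)]rnorm_distC; lra.
Qed.

End Semigroup.

(* With [c = K0 (bd (A x))], both [x - K0 (bd x)] and [b = A x - c] lie in the
   domain of the generator, and [A (x - K0 (bd x)) = b + c]; the Riemann sums of
   [S s c] are therefore those of [S s (b + c)] minus those of [S s b]. *)
Lemma gen_sol_expansion (R : realType) (X : completeNormedModType R[i])
    (Y : normedModType R[i]) (DA : set X) (A : X -> X) (bd : X -> Y)
    (S : R -> X -> X) (K0 : Y -> X) (M k : R) (x : X) :
  lin_subspace DA -> linear_on DA A -> linear_on DA bd ->
  C0_semigroup S -> generator S [set x | DA x /\ bd x = 0] A -> 0 <= M ->
  (forall t x, 0 <= t -> rnorm (S t x) <= M * rnorm x) ->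
  (forall v, [/\ DA (K0 v), A (K0 v) = 0, bd (K0 v) = v &
     forall x, DA x -> A x = 0 -> bd x = v -> x = K0 v]) ->
  0 < k -> DA x -> DA (A x) ->
  rnorm (gen_sol S K0 x (bd x) (bd (A x)) k - (x + k%:C *: A x))
    <= M ^+ 2 * rnorm (A (A x)) * k ^+ 2.
Proof.
move=> [DA0 DAl] Al bdl HS HG M0 SM HK k0 Dx DAx.
have DB y z : DA y -> DA z -> DA (y - z).
  by move=> Dy Dz; rewrite addrC -scaleN1r; exact: DAl.
have AB y z : DA y -> DA z -> A (y - z) = A y - A z.
  by move=> Dy Dz; rewrite addrC -scaleN1r Al // scaleN1r addrC.
have bdB y z : DA y -> DA z -> bd (y - z) = bd y - bd z.
  by move=> Dy Dz; rewrite addrC -scaleN1r bdl // scaleN1r addrC.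
have [DKx AKx bdKx _] := HK (bd x).
set c := K0 (bd (A x)); have [Dc Ac bdc _] := HK (bd (A x)).
set a := x - K0 (bd x); pose b := A x - c.
have Da : DA a /\ bd a = 0 by split; [exact: DB|rewrite bdB // bdKx subrr].
have Aa : A a = A x by rewrite AB // AKx subr0.
have Db : DA b /\ bd b = 0 by split; [exact: DB|rewrite bdB // bdc subrr].
have Ab : A b = A (A x) by rewrite AB // Ac subr0.
(* Additivity of [K0] here comes from uniqueness: the right-hand side lies in the kernel of [A] and
   has the required boundary value. *)
have KE : K0 (bd x + k%:C *: bd (A x)) = K0 (bd x) + k%:C *: c.
  have [_ _ _ HKu] := HK (bd x + k%:C *: bd (A x)); apply/esym/HKu.
  - by rewrite addrC; exact: DAl.
  - by rewrite addrC Al // Ac AKx scaler0 addr0.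
  - by rewrite addrC bdl // bdc bdKx addrC.
have [I cvI Ib] := riemann_sum_orbit_cvg HS HG M0 SM k0 Db.
have cva := riemann_sum_generator HS HG M0 SM k0 Da.
rewrite Aa in cva; rewrite Ab in Ib.
have rintE : rint (fun s => S s c) 0 k = S k a - a - I.
  rewrite rint0E; apply: norm_cvg_lim.
  rewrite (_ : riemann_sum (fun s => S s c) k =
    (fun n => riemann_sum (fun s => S s (A x)) k n - riemann_sum (fun s => S s b) k n)).
    exact: cvgB.
  apply/funext => n; rewrite -riemann_sumB; apply: eq_big_nat => i _.
  congr (_ *: _); rewrite -(semigroupB HS) ?subKr //.
  by rewrite !mulr_ge0 ?ler0n ?invr_ge0 ?ler0n // ltW.
rewrite /gen_sol -/c rintE KE -/a.
(* The terms [S k a] cancel, and [a + K0 (bd x) = x] removes the rest except [I - k b]. *)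
rewrite [X in rnorm X](_ : _ = I - k%:C *: b) // /b scalerBr.
have xE : x = a + K0 (bd x) by rewrite subrK.
clearbody a.
move: xE; set q := K0 (bd x); set l := _ *: A _.
clearbody q l => ->.
set m := S k a; set r := _ *: c; rewrite !opprB !opprD.
rewrite [LHS](AC ((1*2)*(1*2)*3) (4*(3*9)*(1*6)*(2*8)*(5*7))) /=.
by rewrite !subrr !addr0.
Qed.

(** * Lipschitz bounds for the nonlinearity *)

(** Continuity of the derivative bounds it near [(t0, x0)]. The neighbourhood is convex, so the mean
    value inequality applies along the segment joining two of its points. *)
Lemma C1_TX_local_lipschitz (R : realType) (V : normedModType R[i]) (T : R)
    (f : R -> V -> V) (t0 : R) (x0 : V) :
  C1_TX T f -> 0 <= t0 <= T ->
  exists d L : R, [/\ 0 < d, 0 <= L & forall t x t' x',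
    0 <= t <= T -> 0 <= t' <= T -> `|t - t0| < d -> `|t' - t0| < d ->
    rnorm (x - x0) < d -> rnorm (x' - x0) < d ->
    rnorm (f t' x' - f t x) <= L * (`|t' - t| + rnorm (x' - x))].
Proof.
move=> [ft [fx [fxl fd fc]]] t0T.
have [d d0 Hd] := fc t0 x0 t0T 1 ltr01.
have [_ [M HM]] := fxl t0 x0 t0T.
(* One constant dominates both partial derivatives; the absolute value is taken because [M] has no
   known sign. *)
pose L := rnorm (ft t0 x0) + 1 + (`|M| + 1).
have rft0 := rnorm_ge0 (ft t0 x0); have Mge0 := normr_ge0 M.
have ftL t x : 0 <= t <= T -> `|t - t0| < d -> rnorm (x - x0) < d ->
    rnorm (ft t x) <= L.
  move=> tT td xd; have [] := Hd t x tT td; first by rewrite normE ltcR.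
  rewrite normE lecR => h1 _.
  have := rnormD (ft t x - ft t0 x0) (ft t0 x0); rewrite subrK /L; lra.
have fxL t x y : 0 <= t <= T -> `|t - t0| < d -> rnorm (x - x0) < d ->
    rnorm (fx t x y) <= L * rnorm y.
  move=> tT td xd; have [] := Hd t x tT td; first by rewrite normE ltcR.
  move=> _ /(_ y); rewrite !normE -rmorphM lecR /= mul1r => h1.
  have := HM y; rewrite !normE -rmorphM lecR /= => h2.
  have := rnormD (fx t x y - fx t0 x0 y) (fx t0 x0 y); rewrite subrK.
  have ry := rnorm_ge0 y; have := ler_wpM2r ry (ler_norm M).
  have := mulr_ge0 rft0 ry; rewrite /L !mulrDl; lra.
exists d, L; split=> //; first by rewrite /L; lra.
move=> t x t' x' tT t'T td t'd xd x'd.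
set s := t' - t; set y := x' - x.
have xE q : x + q%:C *: y - x0 = (1 - q)%:C *: (x - x0) + q%:C *: (x' - x0).
  rewrite -[x' - x0](subrKA x) -/y [q%:C *: (y + _)]scalerDr addrCA -scalerDl.
  by rewrite -rmorphD /= subrK rmorph1 scale1r addrAC addrC.
have tE q : t + q * s - t0 = (1 - q) * (t - t0) + q * (t' - t0) by rewrite /s; ring.
have cvx q v z : 0 <= q <= 1 -> v < d -> z < d -> (1 - q) * v + q * z < d.
  move=> /andP[q0 q1] vd zd; have [->|qn0] := eqVneq q 0.
    by rewrite subr0 mul1r mul0r addr0.
  have q_gt0 : 0 < q by rewrite lt_neqAle eq_sym qn0.
  have : (1 - q) * v <= (1 - q) * d by apply: ler_wpM2l; lra.
  have : q * z < q * d by rewrite ltr_pM2l.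
  by rewrite mulrBl; lra.
have tq q : 0 <= q <= 1 -> `|t + q * s - t0| < d.
  move=> q01; rewrite tE; apply: le_lt_trans (ler_normD _ _) _; rewrite !normrM.
  by rewrite (ger0_norm (_ : 0 <= 1 - q)) ?(ger0_norm (_ : 0 <= q)) ?cvx //; lra.
have xq q : 0 <= q <= 1 -> rnorm (x + q%:C *: y - x0) < d.
  move=> q01; rewrite xE; apply: le_lt_trans (rnormD _ _) _.
  rewrite !rnormZ.
  by rewrite (ger0_norm (_ : 0 <= 1 - q)) ?(ger0_norm (_ : 0 <= q)) ?cvx //; lra.
have tTq q : 0 <= q <= 1 -> 0 <= t + q * s <= T.
  by move=> q01; rewrite /s; apply/andP; split; nra.
have := @mean_value R V 0 1 (L * (`|s| + rnorm y))
  (fun q => f (t + q * s) (x + q%:C *: y))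
  (fun q => s%:C *: ft (t + q * s) (x + q%:C *: y) + fx (t + q * s) (x + q%:C *: y) y).
rewrite mul1r mul0r rmorph0 rmorph1 scale0r scale1r !addr0 subr0 mulr1.
rewrite /s /y !subrKC; apply; first exact: ler01.
  rewrite -/s -/y; apply/has_deriv_onP => q q01 e e0.
  have [fl _] := fxl (t + q * s) (x + q%:C *: y) (tTq q q01).
  have fx0 : fx (t + q * s) (x + q%:C *: y) 0 = 0.
    have := fl 1 0 0; rewrite rmorph1 !scale1r addr0 => /eqP.
    by rewrite addrC -subr_eq subrr => /eqP.
  have sy0 : 0 < `|s| + rnorm y + 1.
    by have := normr_ge0 s; have := rnorm_ge0 y; lra.
  (* The chain rule error is at most [e' (|s| + |y|) |h|]; the added 1 covers the case of a
     degenerate segment. *)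
  pose e' := e / (`|s| + rnorm y + 1).
  have e'0 : 0 < e' by rewrite divr_gt0.
  have [r r0 Hr] := fd _ (x + q%:C *: y) (tTq q q01) e' e'0.
  exists (r / (`|s| + rnorm y + 1)); first by rewrite divr_gt0.
  move=> h qh; rewrite ltr_pdivlMr // => hr.
  have tqh := tTq _ qh; have h0 := normr_ge0 h.
  have hs : `|h * s| < r.
    apply: le_lt_trans hr; rewrite normrM; apply: ler_wpM2l => //.
    by have := rnorm_ge0 y; lra.
  have hy : rnorm (h%:C *: y) < r.
    apply: le_lt_trans hr; rewrite rnormZ; apply: ler_wpM2l => //.
    by have := normr_ge0 s; lra.
  have := Hr (h * s) (h%:C *: y); rewrite !normE ltcR -rmorphM -rmorphD lecR /=.
  have -> : t + q * s + h * s = t + (q + h) * s by ring.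
  have -> : x + q%:C *: y + h%:C *: y = x + (q + h)%:C *: y.
    by rewrite rmorphD /= scalerDl addrA.
  move=> /(_ tqh hs hy).
  have := fl h y 0; rewrite !addr0 fx0 addr0 => ->.
  rewrite rmorphM -scalerA -addrA -opprD -scalerDr => /le_trans; apply.
  rewrite normrM rnormZ.
  rewrite (_ : e' * (_ * _) + _ = e' * (`|s| + rnorm y) * `|h|); last by ring.
  apply: ler_wpM2r => //; rewrite /e' mulrAC ler_pdivrMr // ler_pM2l //; lra.
move=> q q01; rewrite -/s -/y [leRHS]mulrDr; apply: le_trans (rnormD _ _) _.
apply: lerD; last by apply: fxL; [exact: tTq | exact: tq | exact: xq].
rewrite rnormZ mulrC; apply: ler_wpM2r => //.
by apply: ftL; [exact: tTq | exact: tq | exact: xq].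
Qed.

(** Cousin's lemma in the base time [t]: joining two intervals takes the smaller radius and the sum
    of the constants. *)
Lemma C1_TX_tube_lipschitz (R : realType) (V : normedModType R[i]) (T : R)
    (f : R -> V -> V) (u : R -> V) :
  0 <= T -> C1_TX T f -> {within cI 0 T, continuous u} ->
  exists d L : R, [/\ 0 < d, 0 <= L & forall t s x,
    0 <= t <= T -> 0 <= s -> t + s <= T -> s < d -> rnorm (x - u t) < d ->
    rnorm (f (t + s) x - f t (u t)) <= L * (s + rnorm (x - u t))].
Proof.
move=> T0 fC1 /continuous_withinP uC.
apply: (@cousin R (fun a b => exists d L : R, [/\ 0 < d, 0 <= L & forall t s x,
    a <= t <= b -> 0 <= s -> t + s <= T -> s < d -> rnorm (x - u t) < d ->
    rnorm (f (t + s) x - f t (u t)) <= L * (s + rnorm (x - u t))])) => //.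
  move=> a b c _ _ _ _ [d1 [L1 [d10 L10 H1]]] [d2 [L2 [d20 L20 H2]]].
  exists (Num.min d1 d2), (L1 + L2); split; first by rewrite lt_min d10.
    exact: addr_ge0.
  move=> t s x atc s0 tsT; rewrite !lt_min => /andP[sd1 sd2] /andP[xd1 xd2].
  have q0 : 0 <= s + rnorm (x - u t) by rewrite addr_ge0 // rnorm_ge0.
  have p1 := mulr_ge0 L10 q0; have p2 := mulr_ge0 L20 q0.
  rewrite mulrDl; have [tb|tb] := leP t b.
    by have := H1 t s x; rewrite tb s0 tsT sd1 xd1; lra.
  by have := H2 t s x; rewrite (ltW tb) s0 tsT sd2 xd2; lra.
move=> c c0T; have [d [L [d0 L0 H]]] := C1_TX_local_lipschitz (u c) fC1 c0T.
have d20 : 0 < d / 2 by lra.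
have d30 : 0 < d / 3 by lra.
have [r r0 Hr] := uC c c0T _ d30.
exists (Num.min r (d / 2)); first by rewrite lt_min r0.
move=> a b a0 ac cb bT; rewrite lt_min => /andP[abr abd].
(* Both [t + s] and [x] stay within [d] of the centre: times add up to less than [d / 2 + d / 2],
   states to less than [d / 2 + d / 3]. *)
exists (d / 2), L; split=> // t s x /andP[at_ tb] s0 tsT sd xd.
have uct : rnorm (u t - u c) <= d / 3.
  by apply: Hr; [lra | rewrite ltr_norml; lra].
rewrite -[s in L * (s + _)]ger0_norm // -[s in L * (`|s| + _)](addrK t) [s + t]addrC.
apply: H; rewrite ?ltr_norml; try lra.
have := rnorm_distD (u t) x (u c); lra.
Qed.

(** * Taylor remainder and the nonlinear flow *)

(** The mean value inequality is used twice: [F s - s F1 a] has derivative [F1 s - F1 a], itself at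
    most [B (s - a)]. *)
Lemma taylor2 (R : realType) (V : normedModType R[i]) (a b B : R)
    (F F1 F2 : R -> V) :
  a <= b -> has_deriv_on a b F F1 -> has_deriv_on a b F1 F2 ->
  (forall t, a <= t <= b -> rnorm (F2 t) <= B) ->
  rnorm (F b - F a - (b - a)%:C *: F1 a) <= B * (b - a) ^+ 2.
Proof.
move=> ab HF HF1 F2B.
have := mean_value (M := B * (b - a)) ab (has_deriv_on_affine (v := F1 a) HF) _.
have -> : F b - b%:C *: F1 a - (F a - a%:C *: F1 a) =
    F b - F a - (b - a)%:C *: F1 a.
  by rewrite rmorphB /= scalerBl !opprB [LHS](AC (2*2) (1*4*(3*2))).
rewrite expr2 mulrA; apply=> t /andP[at_ tb].
have B0 : 0 <= B by apply: le_trans (rnorm_ge0 (F2 a)) (F2B a _); rewrite lexx.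
have HF1t := has_deriv_on_sub (lexx a) tb HF1.
apply: le_trans (mean_value (M := B) at_ HF1t _) _.
  by move=> s /andP[as_ st]; apply: F2B; rewrite as_ (le_trans st).
by apply: ler_wpM2l => //; lra.
Qed.

(* A solution starting near [x0] cannot leave the tube of radius [d] before time
   [k], since as long as it stays there its speed is at most [B + L (2 d)]. *)
Lemma euler_step (R : realType) (V : normedModType R[i])
    (k d L B C : R) (F : R -> V -> V) (v : R -> V) (x0 F0 : V) :
  0 < k -> k <= d -> 0 <= L -> 0 <= C ->
  (forall s x, 0 <= s <= k -> rnorm (x - x0) < d ->
     rnorm (F s x - F0) <= L * (s + rnorm (x - x0))) ->
  rnorm F0 <= B -> rnorm (v 0 - x0) <= C * k ->
  (B + L * (2 * d) + C) * k < d ->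
  has_deriv_on 0 k v (fun s => F s (v s)) ->
  rnorm (v k - v 0 - k%:C *: F0) <= L * (1 + C + (B + L * (2 * d))) * k ^+ 2.
Proof.
move=> k0 kd L0 C0 Flip F0B v0x0; set B1 := B + _ => small Hv.
have B10 : 0 <= B1.
  have := rnorm_ge0 F0; have : 0 <= L * (2 * d) by rewrite mulr_ge0 //; lra.
  by rewrite /B1; lra.
have Fle s x : 0 <= s <= k -> rnorm (x - x0) < d -> rnorm (F s x) <= B1.
  move=> sk xd; have := Flip s x sk xd.
  have : L * (s + rnorm (x - x0)) <= L * (2 * d) by apply: ler_wpM2l => //; lra.
  have := rnormD (F s x - F0) F0; rewrite subrK /B1; lra.
have boot s : 0 <= s <= k -> rnorm (v s - v 0) <= B1 * s.
  move=> /andP[s0 sk].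
  (* Continuation is phrased as an implication from time [a] to time [b], which composes trivially
     and starts from the true case at 0. *)
  have := @cousin R (fun a b => rnorm (v a - v 0) <= B1 * a ->
    rnorm (v b - v 0) <= B1 * b) 0 s.
  apply=> //; last by rewrite subrr rnorm0 mulr0.
    by move=> a b c _ _ _ _ ab bc /ab.
  move=> c /andP[c0 cs].
  (* A third of the slack: two such moves added to [(B1 + C) k] stay below [d]. *)
  have del0 : 0 < (d - (B1 + C) * k) / 3 by lra.
  have /continuous_withinP vC := has_deriv_on_continuous Hv.
  have ck : 0 <= c <= k by lra.
  have [r r0 Hr] := vC c ck _ del0.
  exists r => // a b a0 ac cb bs abr ha.
  have tube t : a <= t <= b -> rnorm (v t - x0) < d.
    move=> atb.
    have h1 : rnorm (v t - v c) <= (d - (B1 + C) * k) / 3.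
      by apply: Hr; [lra | rewrite ltr_norml; lra].
    have h2 : rnorm (v a - v c) <= (d - (B1 + C) * k) / 3.
      by apply: Hr; [lra | rewrite ltr_norml; lra].
    have h3 : B1 * a <= B1 * k by apply: ler_wpM2l => //; lra.
    have := rnorm_distD (v c) (v t) x0; have := rnorm_distD (v a) (v c) x0.
    have := rnorm_distD (v 0) (v a) x0; rewrite [rnorm (v c - v a)]rnorm_distC.
    by rewrite mulrDl in del0 h1 h2; lra.
  have ab : a <= b by lra.
  have := mean_value (M := B1) ab (has_deriv_on_sub a0 (le_trans bs sk) Hv).
  have H t : a <= t <= b -> rnorm (F t (v t)) <= B1.
    by move=> atb; apply: Fle; [lra | exact: tube].
  move=> /(_ H); have := rnorm_distD (v a) (v b) (v 0); rewrite mulrBr; lra.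
(* The derivative of [v s - s F0] is [F s (v s) - F0], at most [L (k + (B1 + C) k)]. *)
have := mean_value (M := L * (1 + C + B1) * k)
  (ltW k0) (has_deriv_on_affine (v := F0) Hv).
rewrite rmorph0 scale0r !subr0 [v k - _ - _]addrAC expr2 mulrA; apply=> s sk.
have vs := boot s sk.
have B1s : B1 * s <= B1 * k by apply: ler_wpM2l => //; lra.
have vx : rnorm (v s - x0) <= (B1 + C) * k.
  by have := rnorm_distD (v 0) (v s) x0; rewrite mulrDl; lra.
apply: le_trans (Flip s (v s) sk (le_lt_trans vx small)) _.
rewrite -mulrA; apply: ler_wpM2l => //; rewrite !mulrDl in vx *; lra.
Qed.

(** * Assembly of the local error *)

Unset Implicit Arguments.

Theorem theorem3p2 (R : realType) (X Y : completeNormedModType R[i]) (T : R)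
    (DA : set X) (A : X -> X) (bd : X -> Y) (f : R -> X -> X) (g : R -> Y)
    (u0 : X) (u : R -> X) (S : R -> X -> X) (w : R) (K : R[i] -> Y -> X)
    (Psi : R -> R -> X -> X) (p : nat) :
  0 < T ->
  (* A : D(A) -> X and bd : D(A) -> Y linear *)
  lin_subspace DA -> linear_on DA A -> linear_on DA bd ->
  (* (A1) *)
  (forall y : Y, exists2 x, DA x & bd x = y) ->
  (* (A2) *)
  closure [set x | DA x /\ bd x = 0] = setT ->
  C0_semigroup S -> generator S [set x | DA x /\ bd x = 0] A ->
  negative_type S w ->
  (* (A3) *)
  (forall z : R[i], w < complex.Re z -> forall v : Y,
     [/\ DA (K z v), A (K z v) = z *: K z v, bd (K z v) = v &
         forall x, DA x -> A x = z *: x -> bd x = v -> x = K z v]) ->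
  (forall w0 : R, w < w0 -> exists Cst : R, forall (z : R[i]) (v : Y),
     w0 <= complex.Re z -> `|K z v| <= Cst%:C * `|v|) ->
  (* (A4) *)
  C1_TX T f ->
  (* u solves u' = A u + f(t,u), u(0) = u0, bd u(t) = g(t) on [0,T] *)
  (forall t, 0 <= t <= T -> DA (u t)) ->
  has_deriv_on 0 T u (fun t => A (u t) + f t (u t)) ->
  u 0 = u0 ->
  (forall t, 0 <= t <= T -> bd (u t) = g t) ->
  (* (A5) *)
  C2_on 0 T u ->
  (forall t, 0 <= t <= T -> DA (u t) /\ DA (A (u t))) ->
  C1_on 0 T (fun t => A (u t)) ->
  C1_on 0 T (fun t => A (A (u t))) ->
  (* (A6) *)
  (forall t, 0 <= t <= T -> DA (f t (u t))) ->
  {within cI 0 T, continuous (fun t => A (f t (u t)))} ->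
  (* Psi has order p >= 1 for the problems w' = f(t_n + s, w), w(0) = vbar_n(k) *)
  (1 <= p)%N ->
  (exists Cst : R, exists2 k0 : R, 0 < k0 &
     forall (k : R) (n : nat), 0 < k <= k0 -> n.+1%:R * k <= T ->
       let vbarnk := gen_sol S (K 0) (u (n%:R * k)) (bd (u (n%:R * k)))
                        (bd (A (u (n%:R * k)))) k in
       exists v : R -> X,
         [/\ v 0 = vbarnk,
             has_deriv_on 0 k v (fun s => f (n%:R * k + s) (v s)) &
             `|Psi k (n%:R * k) vbarnk - v k| <= (Cst * k ^+ p.+1)%:C]) ->
  (* conclusion: local error rho_{n+1} = O(k^2) *)
  exists Cst : R, exists2 k0 : R, 0 < k0 &
    forall (k : R) (n : nat), 0 < k <= k0 -> n.+1%:R * k <= T ->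
      let vbarnk := gen_sol S (K 0) (u (n%:R * k)) (bd (u (n%:R * k)))
                       (bd (A (u (n%:R * k)))) k in
      `|Psi k (n%:R * k) vbarnk - u (n.+1%:R * k)| <= (Cst * k ^+ 2)%:C.
Proof.
move=> T0 DAl Al bdl _ _ HS HG [w0 [M0 HM]] HK _ fC1 uD ud _ _ uC2 AuD AuC1 AAuC1 _ _ p1.
move=> [C0 [k0 k00 HPsi]].
pose M := `|M0|.
(* Negative type gives [expR (w * t) <= 1]. *)
have SM t x : 0 <= t -> rnorm (S t x) <= M * rnorm x.
  move=> t0; rewrite -lecR -normE; apply: le_trans (HM t x t0) _.
  rewrite normE -rmorphM lecR; apply: ler_wpM2r; first exact: rnorm_ge0.
  apply: le_trans (ler_wpM2r (expR_ge0 _) (ler_norm M0)) _.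
  by rewrite ler_piMr // -expR0 ler_expR mulr_le0_ge0 // ltW.
(* The value [z = 0] is admissible because [w < 0]. *)
have HK0 (v : Y) : [/\ DA (K 0 v), A (K 0 v) = 0, bd (K 0 v) = v &
    forall x, DA x -> A x = 0 -> bd x = v -> x = K 0 v].
  have [h1 h2 h3 h4] := HK 0 w0 v; split=> //; first by rewrite h2 scale0r.
  by move=> x Dx Ax; apply: h4 => //; rewrite Ax scale0r.
have [F1 [F2 [uF1 F1F2 F2C]]] := uC2.
have F1E := has_deriv_on_uniq T0 uF1 ud.
have [G1 [AuG1 _]] := AuC1; have [G2 [AAuG2 _]] := AAuC1.
have [BA BA0 HBA] := continuous_bounded (ltW T0) (has_deriv_on_continuous AuG1).
have [BAA BAA0 HBAA] := continuous_bounded (ltW T0) (has_deriv_on_continuous AAuG2).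
have [B1 B10 HB1] := continuous_bounded (ltW T0) (has_deriv_on_continuous F1F2).
have [B2 B20 HB2] := continuous_bounded (ltW T0) F2C.
have [d [L [d0 L0 tube]]] :=
  C1_TX_tube_lipschitz (ltW T0) fC1 (has_deriv_on_continuous ud).
(* [CA] measures the defect of [vbar] from [u + k A u], and [C k] its distance from [u]. [V] below
   bounds the speed in the tube. *)
pose CA := M ^+ 2 * BAA; pose C := BA + CA.
have CA0 : 0 <= CA by rewrite mulr_ge0 ?sqr_ge0.
pose V := B1 + BA + L * (2 * d).
have V0 : 0 <= V by rewrite !addr_ge0 // !mulr_ge0 // ltW.
have VC0 : 0 < V + C + 1 by rewrite /C; lra.
(* The summands come from the integrator, the nonlinear flow, the generalized solution and the
   Taylor remainder. *)
exists (`|C0| + L * (1 + C + V) + CA + B2).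
(* [k <= 1] lowers powers of [k], [k <= d / 2] keeps times in the tube, and the last bound gives
   [(V + C) k < d]. *)
exists (Num.min (Num.min k0 1) (Num.min (d / 2) (d / (V + C + 1)))).
  by rewrite !lt_min k00 ltr01 !divr_gt0.
move=> k n /andP[k_gt0]; rewrite !le_min => /andP[/andP[kk0 k1] /andP[kd kVC]] nkT.
cbv zeta; set vbar := gen_sol _ _ _ _ _ _.
have [|v [v0 vd Psiv]] := HPsi k n _ nkT; first by rewrite k_gt0.
rewrite -/vbar in v0 Psiv; set t := n%:R * k in vbar v0 vd Psiv *.
have tk : n.+1%:R * k = t + k by rewrite -natr1 mulrDl mul1r.
rewrite tk in nkT *.
have t0 : 0 <= t by rewrite mulr_ge0 // ltW.
have tT : 0 <= t <= T by rewrite t0 (le_trans _ nkT) // lerDl ltW.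
have vbarE : rnorm (vbar - (u t + k%:C *: A (u t))) <= CA * k ^+ 2.
  have [Du DAu] := AuD t tT.
  apply: le_trans (gen_sol_expansion DAl Al bdl HS HG (normr_ge0 _) SM HK0
    k_gt0 Du DAu) _.
  by apply: ler_wpM2r; rewrite ?sqr_ge0 // ler_wpM2l ?sqr_ge0 // HBAA.
have k2 : k ^+ 2 <= k by rewrite expr2 ler_piMr // ltW.
have vbaru : rnorm (vbar - u t) <= C * k.
  have := rnorm_distD (u t + k%:C *: A (u t)) vbar (u t).
  rewrite [u t + _]addrC addrK rnormZ gtr0_norm // [k%:C *: _ + _]addrC.
  have := ler_wpM2l (ltW k_gt0) (HBA t tT); have := ler_wpM2l CA0 k2.
  by rewrite /C mulrDl; lra.
(* The equation gives [f t (u t) = F1 t - A (u t)]. *)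
have fB : rnorm (f t (u t)) <= B1 + BA.
  have := rnormB (F1 t) (A (u t)); rewrite F1E // [A _ + _]addrC addrK.
  have := HBA t tT; have := HB1 t tT; rewrite F1E // [A _ + _]addrC; lra.
have step : rnorm (v k - vbar - k%:C *: f t (u t)) <= L * (1 + C + V) * k ^+ 2.
  rewrite -v0; apply: (@euler_step R X k d L (B1 + BA) C (fun s => f (t + s))
    v (u t)) => //.
  - lra.
  - by rewrite addr_ge0.
  - move=> s x /andP[s0 sk] xd; apply: tube => //.
      by apply: le_trans nkT; rewrite lerD2l.
    by apply: le_lt_trans sk _; apply: le_lt_trans kd _; rewrite
      ltr_pdivrMr // ltr_pMr // ltr1n.
  - by rewrite v0.
  - rewrite -/V; move: kVC; rewrite ler_pdivlMr // => kVC.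
    by have -> : (V + C) * k = k * (V + C + 1) - k by [ring]; lra.
have tay : rnorm (u (t + k) - u t - k%:C *: (A (u t) + f t (u t))) <= B2 * k ^+ 2.
  have ttk : t <= t + k by rewrite lerDl ltW.
  have := taylor2 (B := B2) ttk
    (has_deriv_on_sub t0 nkT uF1) (has_deriv_on_sub t0 nkT F1F2).
  rewrite [t + k - t]addrAC subrr add0r F1E //; apply=> s /andP[ts st].
  by apply: HB2; rewrite (le_trans t0 ts) (le_trans st nkT).
(* Here [p >= 1] and [k <= 1] reduce [k ^+ p.+1] to [k ^+ 2]. *)
have PsiE : rnorm (Psi k t vbar - v k) <= `|C0| * k ^+ 2.
  rewrite -lecR -normE; apply: le_trans Psiv _; rewrite lecR.
  apply: le_trans (ler_wpM2r (exprn_ge0 _ (ltW k_gt0)) (ler_norm C0)) _.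
  by apply: ler_wpM2l => //; apply: ler_wiXn2l => //; rewrite ltW.
rewrite normE lecR; clearbody vbar.
have -> : Psi k t vbar - u (t + k) = (Psi k t vbar - v k) +
   (v k - vbar - k%:C *: f t (u t)) + (vbar - (u t + k%:C *: A (u t))) -
   (u (t + k) - u t - k%:C *: (A (u t) + f t (u t))).
  rewrite scalerDr; set q := _ *: f _ _; set r := _ *: A _.
  rewrite !opprB !opprD.
  rewrite [RHS](AC (2*3*(1*2)*(2*2)) (1*12*(3*2)*(6*4)*(10*5)*(9*8)*(11*7))) /=.
  by rewrite !subrr !addr0.
apply: le_trans (rnormB _ _) _.
apply: le_trans (lerD (rnormD _ _) (lexx _)) _.
apply: le_trans (lerD (lerD (rnormD _ _) (lexx _)) (lexx _)) _.
by rewrite !mulrDl; lra.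
Qed.
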